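(* Let $ABCD$ be a convex quadrilateral with $AC=BD$, and let $E$ be the intersection of its diagonals $AC$ and $BD$. Let $F$, $G$, $H$, $I$ be the Nagel points of triangles $ABE$, $BCE$, $CDE$, $DAE$, respectively. Then $FH\perp GI$, i.e. the quadrilateral $FGHI$ is orthodiagonal. Furthermore, $FH$ and $GI$ are parallel to the bimedians of $ABCD$: $FH$ is parallel to the line joining the midpoints of $AB$ and $CD$, and $GI$ is parallel to the line joining the midpoints of $BC$ and $DA$.
   Context: A quadrilateral is equidiagonal if its diagonals have equal length, and orthodiagonal if its diagonals are perpendicular. A bimedian of a quadrilateral is the line joining the midpoints of two opposite sides. The Nagel point of a triangle with side lengths $a,b,c$ is the point with trilinear coordinates $\frac{b+c}{a}-1:\frac{c+a}{b}-1:\frac{a+b}{c}-1$, equivalently barycentric coordinates $(b+c-a):(c+a-b):(a+b-c)$. Perpendicularity and parallelism of segments are understood in terms of vectors (a zero vector counts as perpendicular and parallel to everything). *)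

(* Defs.v *)
From HB Require Import structures.
From mathcomp Require Import all_boot all_order all_algebra.
From mathcomp Require Import reals.
Set Implicit Arguments.
Unset Strict Implicit.
Unset Printing Implicit Defensive.
Import Order.TTheory GRing.Theory Num.Theory.
Local Open Scope ring_scope.

(* Points and vectors of the Euclidean plane are both elements of 'rV[R]_2.
   The canonical norm `|_| of MathComp-Analysis on row vectors is the sup norm,
   so the Euclidean structure is set up from the dot product. *)

Definition dot (R : realType) (u v : 'rV[R]_2) : R :=
  \sum_(i < 2) u 0 i * v 0 i.

Definition dist (R : realType) (P Q : 'rV[R]_2) : R :=
  Num.sqrt (dot (Q - P) (Q - P)).

Definition perpendicular (R : realType) (u v : 'rV[R]_2) : Prop :=
  dot u v = 0.

(* Both disjuncts are needed so that the zero vector is parallel to every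
   vector, on either side. *)
Definition parallel (R : realType) (u v : 'rV[R]_2) : Prop :=
  (exists k : R, u = k *: v) \/ (exists k : R, v = k *: u).

Definition midpoint (R : realType) (P Q : 'rV[R]_2) : 'rV[R]_2 :=
  2^-1 *: (P + Q).

Definition on_segment (R : realType) (P Q X : 'rV[R]_2) : Prop :=
  exists t : R, [/\ 0 <= t, t <= 1 & X = (1 - t) *: P + t *: Q].

(* Twice the signed area of the triangle PQX; its sign tells on which side of
   the line PQ the point X lies. *)
Definition orient (R : realType) (P Q X : 'rV[R]_2) : R :=
  (Q - P) 0 0 * (X - P) 0 1 - (Q - P) 0 1 * (X - P) 0 0.

Definition same_side (R : realType) (P Q X Y : 'rV[R]_2) : Prop :=
  0 < orient P Q X * orient P Q Y.

(* For each side, the two remaining vertices lie strictly on the same side of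
   the line through it.  This covers both orientations and rules out
   degenerate, self-intersecting and reflex quadrilaterals. *)
Definition convex_quadrilateral (R : realType) (A B C D : 'rV[R]_2) : Prop :=
  [/\ same_side A B C D, same_side B C D A,
      same_side C D A B & same_side D A B C].

Definition equidiagonal (R : realType) (A B C D : 'rV[R]_2) : Prop :=
  dist A C = dist B D.

Definition orthodiagonal (R : realType) (A B C D : 'rV[R]_2) : Prop :=
  perpendicular (C - A) (D - B).

(* The point with (unnormalized) barycentric coordinates x : y : z with respect
   to the triangle PQS. *)
Definition barycentric (R : realType) (P Q S : 'rV[R]_2) (x y z : R) :
    'rV[R]_2 :=
  (x + y + z)^-1 *: (x *: P + y *: Q + z *: S).

Definition nagel (R : realType) (P Q S : 'rV[R]_2) : 'rV[R]_2 :=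
  let a := dist Q S in
  let b := dist S P in
  let c := dist P Q in
  barycentric P Q S (b + c - a) (c + a - b) (a + b - c).

(* Main.v *)
Require Import Defs.
From HB Require Import structures.
From mathcomp Require Import all_boot all_order all_algebra.
From mathcomp Require Import reals.
From mathcomp Require Import ring lra.
Set Implicit Arguments.
Unset Strict Implicit.
Unset Printing Implicit Defensive.
Import Order.TTheory GRing.Theory Num.Theory.
Local Open Scope ring_scope.

(** Put U = A - C and V = B - D, two vectors of the same length L > 0.  Since E
    lies on both diagonals, the vertices seen from E are A - E = tU,
    B - E = sV, C - E = -(1-t)U and D - E = -(1-s)V with t and s in [0, 1].

    The Nagel point of a triangle with centroid M and incenter J is 3M - 2J.
    In a triangle PQE, the vector J - E lies on the bisector of the angle at
    E, which has the direction U' + V' as soon as P and Q lie on the rays from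
    E along vectors U' and V' of equal length.  So the Nagel point is
    P + Q - E up to a multiple of U' + V' ([nagel_on_rays]).

    For the opposite triangles ABE and CDE this direction is that of U + V, and
    also (C + D) - (A + B) = -(U + V); hence FH is a multiple of U + V, which
    is the direction of the bimedian through the midpoints of AB and CD.  In
    the same way GI and the other bimedian are along U - V.  Finally
    (U + V).(U - V) = L^2 - L^2 = 0: this is where the equality of the
    diagonals gives the perpendicularity. *)

Section EuclideanPlane.
Variable R : realType.
Implicit Types (u v : 'rV[R]_2) (P Q E : 'rV[R]_2).

Definition len u : R := Num.sqrt (dot u u).

Lemma dotE u v : dot u v = u 0 0 * v 0 0 + u 0 1 * v 0 1.
Proof.
rewrite /dot big_ord_recl big_ord1.
by have -> : lift ord0 ord0 = 1 :> 'I_2 by apply/val_inj.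
Qed.

Lemma dotvv_ge0 u : 0 <= dot u u.
Proof. by rewrite dotE -!expr2 addr_ge0 ?sqr_ge0. Qed.

Lemma lenN u : len (- u) = len u.
Proof. by rewrite /len !dotE !mxE !mulrNN. Qed.

Lemma lenZ (k : R) u : 0 <= k -> len (k *: u) = k * len u.
Proof.
move=> k0; rewrite /len -[in RHS](ger0_norm k0) -sqrtr_sqr -sqrtrM ?sqr_ge0 //.
by congr Num.sqrt; rewrite !dotE !mxE; ring.
Qed.

Lemma len_gt0 u : u != 0 -> 0 < len u.
Proof.
apply: contraNT; rewrite sqrtr_gt0 lt_def dotvv_ge0 andbT negbK dotE -!expr2.
rewrite paddr_eq0 ?sqr_ge0 // !sqrf_eq0 => /andP[/eqP u0 /eqP u1].
apply/eqP/rowP => i; rewrite mxE.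
by case: i => [[|[|//]] ilt]; [rewrite -[RHS]u0|rewrite -[RHS]u1];
   congr (u 0 _); apply/val_inj.
Qed.

(** Two vectors of equal length span a rhombus, whose diagonals are
    perpendicular. *)
Lemma rhombus_perpendicular u v (k l : R) :
  len u = len v -> perpendicular (k *: (u + v)) (l *: (u - v)).
Proof.
move=> /(congr1 (fun r => r ^+ 2)); rewrite !sqr_sqrtr ?dotvv_ge0 // => uv.
rewrite /perpendicular; suff -> : dot (k *: (u + v)) (l *: (u - v)) = k * l * (dot u u - dot v v).
  by rewrite uv subrr mulr0.
by rewrite !dotE !mxE; ring.
Qed.

Lemma same_side_neq12 P Q X Y : same_side P Q X Y -> P != Q.
Proof.
by apply: contraTneq => ->; rewrite /orient subrr !mxE !mul0r subrr mul0r ltxx.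
Qed.

Lemma same_side_neq13 P Q X Y : same_side P Q X Y -> P != X.
Proof.
apply: contraTneq => ->; rewrite /orient subrr !mxE !mulr0 subrr mul0r.
by rewrite ltxx.
Qed.

(** With side lengths y|u| opposite P and x|v| opposite Q, the coefficient of
    xu in the Nagel point is 1 - 2y|u|/s and that of yv is 1 - 2x|u|/s, where
    s is the perimeter.  Both corrections equal -2xy|u|/s, so together they
    form a multiple of u + v. *)
Lemma nagel_on_rays E P Q u v (x y : R) :
    0 <= x -> 0 <= y -> P - E = x *: u -> Q - E = y *: v ->
    len u = len v -> 0 < len u -> P != Q ->
  exists k : R, nagel P Q E = P + Q - E + k *: (u + v).
Proof.
move=> x0 y0 Pxu Qyv uv u0 PQ.
have dEP : dist E P = x * len u by rewrite -lenZ // -Pxu.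
have dQE : dist Q E = y * len u by rewrite uv -lenZ // -Qyv -lenN opprB.
have m0 : 0 < dist P Q by apply: len_gt0; rewrite subr_eq0 eq_sym.
rewrite /nagel /barycentric dEP dQE; move: (dist P Q) m0 => m m0.
move: (len u) u0 => L L0.
have xL : 0 <= x * L by rewrite mulr_ge0 // ltW.
have yL : 0 <= y * L by rewrite mulr_ge0 // ltW.
have s0 : x * L + y * L + m != 0 by rewrite gt_eqF //; lra.
exists (- (2 * x * y * L) / (x * L + y * L + m)).
have -> : P = E + x *: u by rewrite -Pxu addrC subrK.
have -> : Q = E + y *: v by rewrite -Qyv addrC subrK.
have -> : x * L + m - y * L + (m + y * L - x * L) + (y * L + x * L - m) =
  x * L + y * L + m by ring.
by apply/rowP => i; rewrite !mxE; field.
Qed.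

Lemma midpointB P Q S T :
  midpoint S T - midpoint P Q = 2^-1 *: ((S + T) - (P + Q)) :> 'rV[R]_2.
Proof. by rewrite /midpoint -scalerBr. Qed.

Lemma parallel_scale (k l : R) u : l != 0 -> parallel (k *: u) (l *: u).
Proof. by move=> l0; left; exists (k / l); rewrite scalerA divfK. Qed.

End EuclideanPlane.

Theorem corollary5p21 (R : realType) (A B C D E F G H I : 'rV[R]_2)
  (hconvex : convex_quadrilateral A B C D)
  (hdiag : equidiagonal A B C D)
  (hEAC : on_segment A C E)
  (hEBD : on_segment B D E)
  (hF : F = nagel A B E)
  (hG : G = nagel B C E)
  (hH : H = nagel C D E)
  (hI : I = nagel D A E) :
  [/\ orthodiagonal F G H I,
      parallel (H - F) (midpoint C D - midpoint A B) &
      parallel (I - G) (midpoint D A - midpoint B C)].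
Proof.
case: hconvex => sAB sBC sCD sDA.
have [t [t0 t1 Et]] := hEAC; have [s [s0 s1 Es]] := hEBD.
have t1' : 0 <= 1 - t by rewrite subr_ge0.
have s1' : 0 <= 1 - s by rewrite subr_ge0.
set U := A - C; set V := B - D.
have UV : len U = len V by rewrite -lenN -[RHS]lenN !opprB.
have U0 : 0 < len U by rewrite len_gt0 // subr_eq0 (same_side_neq13 sAB).
have V0 : 0 < len V by rewrite -UV.
have AE : A - E = t *: U by rewrite Et; apply/rowP => i; rewrite !mxE; ring.
have CE : C - E = (1 - t) *: - U
  by rewrite Et; apply/rowP => i; rewrite !mxE; ring.
have BE : B - E = s *: V by rewrite Es; apply/rowP => i; rewrite !mxE; ring.
have DE : D - E = (1 - s) *: - V
  by rewrite Es; apply/rowP => i; rewrite !mxE; ring.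
have [kF eF] := nagel_on_rays t0 s0 AE BE UV U0 (same_side_neq12 sAB).
have [kG eG] : exists k : R, nagel B C E = B + C - E + k *: (V - U).
  by apply: (nagel_on_rays s0 t1' BE CE); rewrite ?lenN ?(same_side_neq12 sBC).
have [kH eH] : exists k : R, nagel C D E = C + D - E + k *: (- U - V).
  by apply: (nagel_on_rays t1' s1' CE DE); rewrite ?lenN ?(same_side_neq12 sCD).
have [kI eI] : exists k : R, nagel D A E = D + A - E + k *: (- V + U).
  by apply: (nagel_on_rays s1' t0 DE AE); rewrite ?lenN ?(same_side_neq12 sDA).
have FH : H - F = (- 1 - kH - kF) *: (U + V).
  by rewrite hH hF eH eF; apply/rowP => i; rewrite !mxE; ring.
have GI : I - G = (1 + kI + kG) *: (U - V).
  by rewrite hI hG eI eG; apply/rowP => i; rewrite !mxE; ring.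
have mFH : midpoint C D - midpoint A B = (- 2^-1) *: (U + V).
  by rewrite midpointB; apply/rowP => i; rewrite !mxE; ring.
have mGI : midpoint D A - midpoint B C = 2^-1 *: (U - V).
  by rewrite midpointB; apply/rowP => i; rewrite !mxE; ring.
split.
- by rewrite /orthodiagonal FH GI; apply: rhombus_perpendicular.
- by rewrite FH mFH; apply: parallel_scale; rewrite oppr_eq0 invr_eq0 pnatr_eq0.
- by rewrite GI mGI; apply: parallel_scale; rewrite invr_eq0 pnatr_eq0.
Qed.
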